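(* Let $m=10+12q$ with $q=3+4d$ for a nonnegative integer $d$, and let $u=u_0(q)$, so that $q=1+2+\cdots+2^{u-1}+0\cdot 2^u+2^{u+1}r$ for some $r\in\mathbb{Z}$. The minimal decomposition of $\mathbb{Z}_2$ for the Fibonacci polynomial $F_m$ is $$\mathbb{Z}_2=\{0\}\sqcup\Bigl(\bigl(\bigcup_{k=0}^{2^{u+2}-1}A_k\bigr)\cup\bigl(\bigcup_{n\ge 1}\bigcup_{k=0}^{2^{u}-1}M_{n,k}\bigr)\Bigr),$$ where $$A_k=(1+4k+2^{u+4}\mathbb{Z}_2)\cup(2^{u+3}-1-4k+2^{u+4}\mathbb{Z}_2)$$ and $$M_{n,k}=\bigl((1+4k)2^n+2^{n+u+2}\mathbb{Z}_2\bigr)\cup\bigl((2^{u+1}-1-4k)2^n+2^{n+u+2}\mathbb{Z}_2\bigr).$$ Here $\{0\}$ is the set of a fixed point, and the $A_k$'s and $M_{n,k}$'s are the minimal components.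
   Context: $\mathbb{Z}_2$ is the ring of 2-adic integers with the 2-adic metric. The Fibonacci polynomials are defined by $F_0(x)=0$, $F_1(x)=1$, $F_m(x)=xF_{m-1}(x)+F_{m-2}(x)$ for $m\ge 2$. For a nonnegative integer $q$ with binary expansion $q=\sum_{i\ge 0}c_i2^i$, $c_i\in\{0,1\}$ (with $c_i=0$ for all large $i$), define $u_0(q)=\min\{i\ge 1: c_i=0\}$. For a polynomial $f$ over $\mathbb{Z}_2$, a minimal decomposition of $\mathbb{Z}_2$ for $f$ is a decomposition $\mathbb{Z}_2=\mathcal P\sqcup\mathcal M\sqcup\mathcal B$ (some parts possibly empty) in which: $\mathcal P$ is the finite set consisting of all periodic points of $f$; $\mathcal M=\bigsqcup_i\mathcal M_i$ is the union of all (at most countably many) clopen $f$-invariant sets $\mathcal M_i$ (the minimal components), each a finite union of balls, such that each $f:\mathcal M_i\to\mathcal M_i$ is minimal (every orbit is dense in $\mathcal M_i$); and each point of $\mathcal B$ lies in the attracting basin of a periodic orbit or of a minimal subsystem. *)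

(* Defs.v *)
From HB Require Import structures.
From mathcomp Require Import all_boot all_order all_algebra.
From mathcomp Require Import boolp classical_sets cardinality topology.

Set Implicit Arguments.
Unset Strict Implicit.
Unset Printing Implicit Defensive.

Import Order.TTheory GRing.Theory Num.Theory.

Local Open Scope classical_set_scope.
Local Open Scope ring_scope.

(* Z_2 as the inverse limit of the rings Z/2^n: [res x n] is the remainder of
   x modulo 2^n.  The compatibility condition forces [res x n < 2 ^ n].       *)
Record Z2 := MkZ2 {
  res : nat -> nat;
  _ : `[< forall n, res n = res n.+1 %% 2 ^ n >]%N }.

HB.instance Definition _ := [isSub for res].
HB.instance Definition _ := [Choice of Z2 by <:].

Lemma res_mod (x : Z2) k n : (k <= n)%N -> res x k = (res x n %% 2 ^ k)%N.
Proof.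
case: x => r /= /asboolP rP.
have rk j : (r j %% 2 ^ j)%N = r j by rewrite [in RHS]rP rP modn_mod.
elim: n => [|n IHn]; first by rewrite leqn0 => /eqP ->; rewrite rk.
rewrite leq_eqVlt => /predU1P[->|]; first by rewrite rk.
by rewrite ltnS => kn; rewrite (IHn kn) rP modn_dvdm // dvdn_exp2l.
Qed.

Lemma res_id (x : Z2) n : (res x n %% 2 ^ n)%N = res x n.
Proof. by rewrite -res_mod. Qed.

Lemma res_inj (x y : Z2) : (forall n, res x n = res y n) -> x = y.
Proof. by move=> xy; apply/val_inj/funext => n; exact: xy. Qed.

Fact Z2mk_subproof (F : nat -> nat) :
  (forall n, F n.+1 = F n %[mod 2 ^ n])%N ->
  `[< forall n, F n %% 2 ^ n = (F n.+1 %% 2 ^ n.+1) %% 2 ^ n >]%N.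
Proof.
by move=> FP; apply/asboolP => n; rewrite modn_dvdm ?FP // dvdn_exp2l.
Qed.

Definition Z2mk (F : nat -> nat) (FP : forall n, (F n.+1 = F n %[mod 2 ^ n])%N)
  : Z2 := MkZ2 (Z2mk_subproof FP).

Fact Z2nat_subproof (c n : nat) : (c = c %[mod 2 ^ n])%N.
Proof. by []. Qed.

Fact Z2add_subproof (x y : Z2) n :
  (res x n.+1 + res y n.+1 = res x n + res y n %[mod 2 ^ n])%N.
Proof. by rewrite -modnDm -!res_mod. Qed.

Fact Z2mul_subproof (x y : Z2) n :
  (res x n.+1 * res y n.+1 = res x n * res y n %[mod 2 ^ n])%N.
Proof. by rewrite -modnMm -!res_mod. Qed.

Fact Z2opp_subproof (x : Z2) n :
  (2 ^ n.+1 - res x n.+1 = 2 ^ n - res x n %[mod 2 ^ n])%N.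
Proof.
have lt_res m : (res x m < 2 ^ m)%N by rewrite -res_id ltn_mod expn_gt0.
apply/eqP; rewrite -(eqn_modDr (res x n.+1)) subnK ?(ltnW (lt_res _)) //.
rewrite -[X in _ == X]modnDmr -res_mod //.
by rewrite subnK ?(ltnW (lt_res _)) // modnn expnS modnMl.
Qed.

Definition Z2zero : Z2 := Z2mk (Z2nat_subproof 0).
Definition Z2one : Z2 := Z2mk (Z2nat_subproof 1).
Definition Z2add (x y : Z2) : Z2 := Z2mk (Z2add_subproof x y).
Definition Z2mul (x y : Z2) : Z2 := Z2mk (Z2mul_subproof x y).
Definition Z2opp (x : Z2) : Z2 := Z2mk (Z2opp_subproof x).

Fact Z2addA : associative Z2add.
Proof. by move=> x y z; apply: res_inj => n /=; rewrite modnDmr modnDml addnA. Qed.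

Fact Z2addC : commutative Z2add.
Proof. by move=> x y; apply: res_inj => n /=; rewrite addnC. Qed.

Fact Z2add0 : left_id Z2zero Z2add.
Proof. by move=> x; apply: res_inj => n /=; rewrite mod0n add0n res_id. Qed.

Fact Z2addN : left_inverse Z2zero Z2opp Z2add.
Proof.
move=> x; apply: res_inj => n /=; rewrite modnDml subnK ?modnn ?mod0n //.
by rewrite -res_id ltnW // ltn_mod expn_gt0.
Qed.

HB.instance Definition _ :=
  GRing.isZmodule.Build Z2 Z2addA Z2addC Z2add0 Z2addN.

Fact Z2mulA : associative Z2mul.
Proof. by move=> x y z; apply: res_inj => n /=; rewrite modnMmr modnMml mulnA. Qed.

Fact Z2mulC : commutative Z2mul.
Proof. by move=> x y; apply: res_inj => n /=; rewrite mulnC. Qed.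

Fact Z2mul1 : left_id Z2one Z2mul.
Proof. by move=> x; apply: res_inj => n /=; rewrite modnMml mul1n res_id. Qed.

Fact Z2mulDl : left_distributive Z2mul Z2add.
Proof.
by move=> x y z; apply: res_inj => n /=; rewrite modnMml modnDm mulnDl.
Qed.

Fact Z2one_neq0 : Z2one != Z2zero.
Proof. by apply/eqP => /(congr1 (fun x => res x 1)). Qed.

HB.instance Definition _ := GRing.Zmodule_isComNzRing.Build Z2
  Z2mulA Z2mulC Z2mul1 Z2mulDl Z2one_neq0.

(* The 2-adic absolute value 2^-v(x), where v(x) is the largest n such that
   2^n divides x; it takes rational values.                                   *)
Definition Z2abs (x : Z2) : rat :=
  match pselect (exists n, res x n.+1 != 0%N) with
  | left nz => 2 ^- (ex_minn nz)
  | right _ => 0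
  end.

Lemma res0 n : res (0 : Z2) n = 0%N. Proof. exact: mod0n. Qed.

Lemma resD (x y : Z2) n : res (x + y) n = ((res x n + res y n) %% 2 ^ n)%N.
Proof. by []. Qed.

Lemma Z2abs_le (x : Z2) k : (Z2abs x <= 2 ^- k) = (res x k == 0%N).
Proof.
rewrite /Z2abs; case: pselect => [nz|z]; last first.
  rewrite invr_ge0 exprn_ge0 //; apply/esym.
  case: k => [|k]; first by rewrite -res_id modn1.
  by apply/negPn/negP => xk; apply: z; exists k.
case: ex_minnP => v xv vmin.
rewrite lef_pV2 ?posrE ?exprn_gt0 // ler_eXn2l //.
apply/idP/eqP => [|xk]; last first.
  rewrite leqNgt; apply/negP => vk; move: xv.
  by rewrite (res_mod x vk) xk mod0n.
case: k => [|k] kv; first by rewrite -res_id modn1.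
by apply/eqP/negPn/negP => /vmin; rewrite leqNgt kv.
Qed.

Lemma Z2absP (x : Z2) : Z2abs x = 0 \/ exists v, Z2abs x = 2 ^- v.
Proof.
by rewrite /Z2abs; case: pselect => [nz|_]; [right; exists (ex_minn nz)|left].
Qed.

Lemma Z2abs_ge0 (x : Z2) : 0 <= Z2abs x.
Proof.
by case: (Z2absP x) => [->|[v ->]] //; rewrite invr_ge0 exprn_ge0.
Qed.

Lemma Z2abs_eq0 (x : Z2) : Z2abs x = 0 -> x = 0.
Proof.
move=> x0; apply: res_inj => n; rewrite res0; apply/eqP.
by rewrite -Z2abs_le x0 invr_ge0 exprn_ge0.
Qed.

Lemma Z2abs0 : Z2abs 0 = 0.
Proof.
rewrite /Z2abs; case: pselect => // nz; exfalso.
by case: nz => n; rewrite res0.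
Qed.

Lemma Z2absN (x : Z2) : Z2abs (- x) = Z2abs x.
Proof.
have le y : Z2abs (- y) <= Z2abs y.
  case: (Z2absP y) => [y0|[v yv]].
    by rewrite y0 (Z2abs_eq0 y0) oppr0 Z2abs0.
  have /eqP yv0 : res y v == 0%N by rewrite -Z2abs_le yv.
  have := resD (- y) y v; rewrite addNr res0 yv0 addn0 res_id => Nyv.
  by rewrite yv Z2abs_le -Nyv.
by apply/eqP; rewrite eq_le le -[in leLHS](opprK x) le.
Qed.

Lemma Z2absD (x y : Z2) : Z2abs (x + y) <= Num.max (Z2abs x) (Z2abs y).
Proof.
wlog le_xy : x y / Z2abs x <= Z2abs y => [wlg|].
  by case/orP: (le_total (Z2abs x) (Z2abs y)) => /wlg //; rewrite addrC maxC.
rewrite max_r //; case: (Z2absP y) => [y0|[v yv]].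
  by move: le_xy; rewrite (Z2abs_eq0 y0) addr0.
rewrite yv Z2abs_le resD.
have /eqP -> : res y v == 0%N by rewrite -Z2abs_le yv.
have /eqP -> : res x v == 0%N by rewrite -Z2abs_le -yv.
by rewrite mod0n.
Qed.

Definition Z2dist (x y : Z2) : rat := Z2abs (x - y).

Fact Z2distxx x : Z2dist x x = 0.
Proof. by rewrite /Z2dist subrr Z2abs0. Qed.

Fact Z2dist_positivity x y : Z2dist x y = 0 -> x = y.
Proof. by move/Z2abs_eq0/eqP; rewrite subr_eq0 => /eqP. Qed.

Fact Z2dist_sym x y : Z2dist x y = Z2dist y x.
Proof. by rewrite /Z2dist -Z2absN opprB. Qed.

Fact Z2dist_triangle y x z : Z2dist x z <= Z2dist x y + Z2dist y z.
Proof.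
rewrite /Z2dist -(subrKA y x) (le_trans (Z2absD _ _)) //.
by rewrite ge_max lerDl lerDr !Z2abs_ge0.
Qed.

HB.instance Definition _ := isMetric.Build rat Z2
  Z2distxx Z2dist_positivity Z2dist_sym Z2dist_triangle.

Fixpoint fibpoly (R : nzRingType) (m : nat) : {poly R} :=
  match m with
  | 0 => 0
  | 1 => 1
  | (m'.+1 as m1).+1 => 'X * fibpoly R m1 + fibpoly R m'
  end.

Definition binary_digit (q i : nat) : bool := odd (q %/ 2 ^ i).

Fact u0_subproof (q : nat) : exists i, (1 <= i)%N && ~~ binary_digit q i.
Proof.
exists q.+1; rewrite /binary_digit divn_small //.
by rewrite (ltn_trans (ltnSn q)) // ltn_expl.
Qed.

Definition u0 (q : nat) : nat := ex_minn (u0_subproof q).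

Section Dynamics.
Variable f : Z2 -> Z2.

Definition forward_orbit (x : Z2) : set Z2 := range (fun n => iter n f x).

Definition periodic_point (x : Z2) : Prop :=
  exists2 n, (0 < n)%N & iter n f x = x.

Definition attracting_basin (E : set Z2) : set Z2 :=
  [set x | forall e : rat, 0 < e ->
     \forall n \near \oo, exists2 y, E y & ball y e (iter n f x)].

Definition finite_union_of_balls (C : set Z2) : Prop :=
  exists s : seq (Z2 * rat), (forall b, b \in s -> 0 < b.2) /\
    C = \bigcup_(b in [set` s]) ball b.1 b.2.

Definition minimal_on (C : set Z2) : Prop :=
  forall x, C x -> C `<=` closure (forward_orbit x).

(* Components are nonempty by convention: the empty set is otherwise vacuously
   minimal.                                                                   *)
Record minimal_component (C : set Z2) : Prop := MinimalComponent {
  component_nonempty : C !=set0;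
  component_clopen : clopen C;
  component_balls : finite_union_of_balls C;
  component_invariant : f @` C `<=` C;
  component_minimal : minimal_on C
}.

End Dynamics.

(* The decomposition Z_2 = P |_| M |_| B, where the minimal components making
   up M are listed without repetition as C i for i in D.                      *)
Record minimal_decomposition (f : {poly Z2}) (P M B : set Z2)
    (I : Type) (D : set I) (C : I -> set Z2) : Prop := MinimalDecomposition {
  decomposition_cover : P `|` M `|` B = setT;
  decomposition_disjoint :
    [/\ P `&` M = set0, P `&` B = set0 & M `&` B = set0];
  decomposition_finite : finite_set P;
  decomposition_periodic : P = [set x | periodic_point (horner f) x];
  decomposition_union : M = \bigcup_(i in D) C i;
  decomposition_trivIset : trivIset D C;
  decomposition_countable : countable D;
  decomposition_components : C @` D = [set S | minimal_component (horner f) S];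
  decomposition_basin : forall x, B x ->
    (exists2 p, periodic_point (horner f) p &
       attracting_basin (horner f) (forward_orbit (horner f) p) x) \/
    (exists2 i, D i & attracting_basin (horner f) (C i) x)
}.

(* c + 2^k Z_2 *)
Definition coset2 (c : Z2) (k : nat) : set Z2 :=
  range (fun z : Z2 => c + 2 ^+ k * z).

Definition setA (u k : nat) : set Z2 :=
  coset2 (1 + 4 * k%:R) (u + 4)
  `|` coset2 (2 ^+ (u + 3) - 1 - 4 * k%:R) (u + 4).

Definition setM (u n k : nat) : set Z2 :=
  coset2 ((1 + 4 * k%:R) * 2 ^+ n) (n + u + 2)
  `|` coset2 ((2 ^+ (u + 1) - 1 - 4 * k%:R) * 2 ^+ n) (n + u + 2).

(* The index [inl k] stands for A_k and [inr (n, k)] for M_{n,k}. *)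
Definition index_AM (u : nat) : set (nat + nat * nat) :=
  [set i | match i with
           | inl k => (k < 2 ^ (u + 2))%N
           | inr (n, k) => (1 <= n)%N /\ (k < 2 ^ u)%N
           end].

Definition component_AM (u : nat) (i : nat + nat * nat) : set Z2 :=
  match i with
  | inl k => setA u k
  | inr (n, k) => setM u n k
  end.

(* Main.v *)
Require Import Defs.
From mathcomp Require Import all_boot all_order all_algebra.
From mathcomp Require Import boolp classical_sets cardinality topology.
From mathcomp Require Import zify ring.

Set Implicit Arguments.
Unset Strict Implicit.
Unset Printing Implicit Defensive.

Import Order.TTheory GRing.Theory Num.Theory.
Local Open Scope classical_set_scope.
Local Open Scope ring_scope.

(** Put N = m + 2, so that N = 12 * 2^u * (1 + 2r), and let f = F_m.  Since
F_{-2} = -x, and N is highly divisible by 2, the map f is close to x |-> -x.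
Write f(x) = -x + h(x), a = F_N and c = F_{N+1} - 1; then
h = (1 + x^2) a - x c.

Two facts on h govern the dynamics.

- h is 4-Lipschitz on each parity class ([fib_flat]).  The functions with
  values in 2^i Z_2 and Lipschitz constant 2^i there form a filtration
  compatible with products ([flat], [flatM]); a and c lie in level 1 for N = 12,
  climb one level when N doubles, and keep their level when N is multiplied.

- The valuation of h(x) depends only on that of x ([fib_val]): it is u + 3 when
  x is a unit and n + u + 1 when x has valuation n > 0.  The valuation of a
  comes from the factorization of F_12 and grows by one at each doubling.  The
  passage from a to h uses Cassini's identity, which gives
  h (2 + c - x a) = a (2 + x^2 + terms divisible by 4), the cofactor on the left
  having valuation 1.

Let K - 1 be the valuation of h(x).  As f is odd, h is odd too, and
f(f(x)) - x = h(f(x)) - h(x), where h(f(x)) is congruent to h(-x) = -h(x) modulo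
4 h(x).  So g = f o f moves x by exactly valuation K, and g - id is again
4-Lipschitz on the points of a given valuation ([f_drifting]).  These two
properties pass from g to g o g with K replaced by K + 1 ([drifting_double]).
Hence iterates of g correct the successive binary digits of x one at a time:
every orbit of g is dense in x + 2^K Z_2 ([drifting_reach]) and no nonzero point
is periodic ([drifting_aperiodic]).  Moreover f sends x + 2^K Z_2 into
2^(K-1) - x + 2^K Z_2, and the union of these two cosets is a minimal component
([pair_of_cosets_minimal]).  The A_k are the unions of this shape for n = 0 and
the M_{n,k} those for n > 0; they cover all nonzero points, and a minimal
component equals any other one that it meets in a nonzero point, so there are no
further ones ([minimal_component_pair]). *)

(** * Divisibility by powers of 2 and valuation in Z_2 *)

Definition dvd2 (k : nat) (x : Z2) : Prop := exists c, x = 2 ^+ k * c.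

(** The valuation is a relation, which avoids a value at 0; the odd cofactor
is written 1 + 2c so that identities can be checked by [ring]. *)
Definition val2 (k : nat) (x : Z2) : Prop := exists c, x = 2 ^+ k * (1 + 2 * c).

Lemma res_nat (a n : nat) : res (a%:R : Z2) n = (a %% 2 ^ n)%N.
Proof.
elim: a => [|a IH]; first by rewrite res0 mod0n.
by rewrite -natr1 resD IH /= modnDm addn1.
Qed.

Lemma resM (x y : Z2) n : res (x * y) n = ((res x n * res y n) %% 2 ^ n)%N.
Proof. by []. Qed.

Lemma res_lt (x : Z2) n : (res x n < 2 ^ n)%N.
Proof. by rewrite -res_id ltn_mod expn_gt0. Qed.

Lemma res_exp2 k n : res (2 ^+ k : Z2) n = (2 ^ k %% 2 ^ n)%N.
Proof. by rewrite -natrX res_nat. Qed.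

(** Dividing by 2^k shifts the sequence of residues by k. *)
Fact shift_subproof (k : nat) (x : Z2) n :
  (res x (n.+1 + k) %/ 2 ^ k = res x (n + k) %/ 2 ^ k %[mod 2 ^ n])%N.
Proof.
rewrite (@res_mod x (n + k) (n.+1 + k)) ?leq_add2r // expnD.
by rewrite -modn_divl // modn_mod.
Qed.

Lemma dvd2P k x : dvd2 k x <-> res x k = 0%N.
Proof.
split=> [[c ->]|xk]; first by rewrite resM res_exp2 modnn mul0n mod0n.
exists (Z2mk (shift_subproof k x)); apply: res_inj => n.
rewrite resM res_exp2 modnMml /= modnMmr.
have -> : (2 ^ k * (res x (n + k) %/ 2 ^ k) = res x (n + k))%N.
  rewrite mulnC divnK // /dvdn -res_mod ?leq_addl //; exact/eqP.
by rewrite -res_mod ?leq_addr.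
Qed.

Lemma dvd2_res (x : Z2) k : dvd2 k (x - (res x k)%:R).
Proof.
apply/dvd2P; have := resD (x - (res x k)%:R) (res x k)%:R k.
rewrite subrK res_nat res_id => e; apply/eqP.
have := res_lt (x - (res x k)%:R) k; have := res_lt x k.
set a := res x k in e *; set b := res _ k in e *.
move: (2 ^ k)%N e => p e ap bp.
have: (0 + a == b + a %[mod p])%N by rewrite -e add0n modn_small.
by rewrite eqn_modDr mod0n (modn_small bp) eq_sym.
Qed.

Lemma mul2_eq0 (x : Z2) : 2 * x = 0 -> x = 0.
Proof.
move=> x0; apply: res_inj => n; rewrite res0 (@res_mod x n n.+1) //.
have := congr1 (fun z => res z n.+1) x0.
rewrite resM res0 (res_nat 2) modnMml => /eqP; rewrite -/(dvdn _ _).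
rewrite expnS dvdn_pmul2l // => /eqP; exact.
Qed.

Lemma one_not_even (c : Z2) : 1 <> 2 * c.
Proof.
move/(congr1 (fun z => res z 1)).
by rewrite resM (res_nat 1) (res_nat 2) mul0n.
Qed.

Lemma Z2_parity (x : Z2) : exists c, x = 2 * c \/ x = 1 + 2 * c.
Proof.
have [c /eqP] := dvd2_res x 1; have := res_lt x 1.
rewrite subr_eq expr1; case: (res x 1) => [|[|//]] _ /eqP ->; exists c.
  by left; rewrite addr0.
by right; rewrite addrC.
Qed.

Lemma dvd2_sep (x : Z2) : (forall k, dvd2 k x) -> x = 0.
Proof. by move=> h; apply: res_inj => k; rewrite res0; exact/dvd2P. Qed.
Lemma exp2_inj k (x y : Z2) : 2 ^+ k * x = 2 ^+ k * y -> x = y.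
Proof.
elim: k => [|k IH]; first by rewrite !mul1r.
rewrite !exprS -!mulrA => /eqP; rewrite -subr_eq0 -mulrBr => /eqP/mul2_eq0/eqP.
by rewrite subr_eq0 => /eqP/IH.
Qed.

Lemma dvd2W j k x : (j <= k)%N -> dvd2 k x -> dvd2 j x.
Proof.
by move=> /subnKC <- [c ->]; exists (2 ^+ (k - j) * c); rewrite exprD mulrA.
Qed.

Lemma dvd2D k x y : dvd2 k x -> dvd2 k y -> dvd2 k (x + y).
Proof. by move=> [a ->] [b ->]; exists (a + b); rewrite mulrDr. Qed.

Lemma dvd2N k x : dvd2 k x -> dvd2 k (- x).
Proof. by move=> [a ->]; exists (- a); rewrite mulrN. Qed.

Lemma dvd2B k x y : dvd2 k x -> dvd2 k y -> dvd2 k (x - y).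
Proof. by move=> kx ky; apply: dvd2D => //; exact: dvd2N. Qed.

Lemma dvd2_sym k x y : dvd2 k (x - y) -> dvd2 k (y - x).
Proof. by move=> /dvd2N; rewrite opprB. Qed.

Lemma dvd2_trans k y x z : dvd2 k (x - y) -> dvd2 k (y - z) -> dvd2 k (x - z).
Proof. by move=> xy yz; rewrite -(subrKA y x); exact: dvd2D. Qed.

Lemma dvd2Ml k x y : dvd2 k x -> dvd2 k (x * y).
Proof. by move=> [a ->]; exists (a * y); rewrite mulrA. Qed.

Lemma val2_dvd2 k x : val2 k x -> dvd2 k x.
Proof. by move=> [c ->]; exists (1 + 2 * c). Qed.

Lemma val2_ndvd2 j k x : (k < j)%N -> val2 k x -> ~ dvd2 j x.
Proof.
move=> kj [c ->] /(dvd2W kj)[e].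
rewrite exprSr -mulrA => /exp2_inj.
by move/(congr1 (fun z => z - 2 * c)); rewrite addrK -mulrBr => /one_not_even.
Qed.

Lemma val2_uniq j k x : val2 j x -> val2 k x -> j = k.
Proof.
move=> jx kx; case: (ltngtP j k) => // lt; exfalso.
  exact: (val2_ndvd2 lt jx (val2_dvd2 kx)).
exact: (val2_ndvd2 lt kx (val2_dvd2 jx)).
Qed.

Lemma val2_neq0 k x : val2 k x -> x <> 0.
Proof.
by move=> kx x0; apply: (val2_ndvd2 (ltnSn k) kx); exists 0; rewrite x0 mulr0.
Qed.

Lemma val2_ex x : x <> 0 -> exists k, val2 k x.
Proof.
move=> x0; have [k nk] : exists k, ~~ (res x k == 0%N).
  apply: contra_notP x0 => nex; apply: dvd2_sep => k; apply/dvd2P/eqP.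
  by apply/negPn/negP => kx; apply: nex; exists k.
case: (ex_minnP (ex_intro (fun k => ~~ (res x k == 0%N)) k nk)) => {k nk} [[|k]].
  by rewrite -res_id modn1.
move=> nk kmin; have /dvd2P[c xc] : res x k = 0%N.
  by apply/eqP/negPn/negP => /kmin; rewrite ltnn.
exists k; case: (Z2_parity c) => e [ce|ce]; last by exists e; rewrite xc ce.
by case/negP: nk; apply/eqP/dvd2P; exists e; rewrite xc ce exprSr mulrA.
Qed.

Lemma val2M j k x y : val2 j x -> val2 k y -> val2 (j + k) (x * y).
Proof.
move=> [a ->] [b ->]; exists (a + b + 2 * a * b); rewrite exprD; ring.
Qed.

Lemma val2N k x : val2 k x -> val2 k (- x).
Proof. by move=> [c ->]; exists (- c - 1); ring. Qed.

Lemma val2D j k x y : (j < k)%N -> val2 j x -> dvd2 k y -> val2 j (x + y).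
Proof.
move=> jk [a ->] /(dvd2W jk)[b ->]; exists (a + b); rewrite exprSr; ring.
Qed.

Lemma val2D_same k x y : val2 k x -> val2 k y -> dvd2 k.+1 (x + y).
Proof.
by move=> [a ->] [b ->]; exists (1 + a + b); rewrite exprSr; ring.
Qed.

(** Z_2 has no zero divisors: this is how the valuation of a factor is read
off from that of a product. *)
Lemma val2_cancel j k x y : val2 j y -> val2 (k + j) (x * y) -> val2 k x.
Proof.
move=> jy xy; have [x0|/eqP/val2_ex[i ix]] := eqVneq x 0.
  by have := val2_neq0 xy; rewrite x0 mul0r.
by have /eqP := val2_uniq (val2M ix jy) xy; rewrite eqn_add2r => /eqP <-.
Qed.

(** The digit of index k decides between the two cases. *)
Lemma dvd2_stepP k x : dvd2 k x -> dvd2 k.+1 x \/ val2 k x.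
Proof.
move=> [c ->]; case: (Z2_parity c) => e [->|->]; [left|right]; exists e => //.
by rewrite exprSr mulrA.
Qed.

(** * Functions that are 2-adically small and Lipschitz on parity classes *)

(** Points of the same parity are written x and x + 2z, with difference
2z.  The Lipschitz condition is confined to parity classes because x^2 is
2-Lipschitz there but only 1-Lipschitz on Z_2. *)
Definition flat (i : nat) (phi : Z2 -> Z2) : Prop :=
  (forall x, dvd2 i (phi x)) /\
  (forall x z, exists w, phi (x + 2 * z) - phi x = 2 ^+ i * (2 * z) * w).

Lemma flat_ext i phi psi : phi =1 psi -> flat i phi -> flat i psi.
Proof. by move=> /funext ->. Qed.

Lemma flatW i j phi : (j <= i)%N -> flat i phi -> flat j phi.
Proof.
move=> ji [v l]; split=> [x|x z]; first exact: dvd2W (v x).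
have [w ->] := l x z; exists (2 ^+ (i - j) * w).
rewrite -(subnKC ji) exprD addKn; ring.
Qed.

Lemma flatD i phi psi : flat i phi -> flat i psi -> flat i (fun x => phi x + psi x).
Proof.
move=> [vf lf] [vg lg]; split=> [x|x z]; first exact: dvd2D.
have [w e] := lf x z; have [w' e'] := lg x z; exists (w + w').
by rewrite opprD addrACA e e' mulrDr.
Qed.

(** Smallness of one factor makes up for the other one's Lipschitz constant,
so the levels add up as in a graded algebra. *)
Lemma flatM i j phi psi :
  flat i phi -> flat j psi -> flat (i + j) (fun x => phi x * psi x).
Proof.
move=> [vf lf] [vg lg]; split=> [x|x z].
  by have [[a ->] [b ->]] := (vf x, vg x); exists (a * b); rewrite exprD; ring.
have [[w e] [w' e']] := (lf x z, lg x z).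
have [[a ea] [b eb]] := (vf (x + 2 * z), vg x).
exists (a * w' + b * w); set X := x + 2 * z in e e' ea *.
have -> : phi X * psi X - phi x * psi x =
  phi X * (psi X - psi x) + psi x * (phi X - phi x) by ring.
rewrite e e' ea eb exprD; ring.
Qed.

Lemma flat_cst i c : flat i (fun=> 2 ^+ i * c).
Proof. by split=> [x|x z]; [exists c|exists 0; rewrite subrr mulr0]. Qed.

Lemma flat0_cst c : flat 0 (fun=> c).
Proof. by split=> [x|x z]; [exists c; rewrite mul1r|exists 0; rewrite subrr mulr0]. Qed.

Lemma flat_id : flat 0 id.
Proof.
split=> [x|x z]; first by exists x; rewrite mul1r.
by exists 1; rewrite addrC addKr; ring.
Qed.

Lemma flatB i phi psi : flat i phi -> flat i psi -> flat i (fun x => phi x - psi x).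
Proof.
move=> fp fq; apply: flatD => //; have := flatM (flat0_cst (-1)) fq.
by rewrite add0n; congr flat; apply/funext => x; rewrite mulN1r.
Qed.

Lemma flatMl i phi psi : flat 0 phi -> flat i psi -> flat i (fun x => phi x * psi x).
Proof. by move=> fp fq; have := flatM fp fq. Qed.

Lemma flat2 i phi : flat i phi -> flat i.+1 (fun x => 2 * phi x).
Proof. by move=> fp; have := flatM (flat_cst 1 1) fp; rewrite mulr1. Qed.

Lemma flat0_sqD c : flat 0 (fun x => x ^+ 2 + c).
Proof.
by apply: flatD; [exact: (flatM flat_id flat_id)|exact: flat0_cst].
Qed.

(** The values are even because x^2 and x^2 + 1 have opposite parities; the
function gains a factor 2 in its Lipschitz constant through x^2. *)
Lemma flat_sq_pronic : flat 1 (fun x => x ^+ 2 * (x ^+ 2 + 1)).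
Proof.
split=> [x|x z].
  case: (Z2_parity x) => c [->|->].
    by exists (2 * c ^+ 2 * (4 * c ^+ 2 + 1)); ring.
  by exists ((1 + 2 * c) ^+ 2 * (1 + 2 * c + 2 * c ^+ 2)); ring.
by exists ((x + z) * ((x + 2 * z) ^+ 2 + x ^+ 2 + 1)); ring.
Qed.

(** * Fibonacci polynomials *)

Notation fib m x := (fibpoly Z2 m).[x].

Lemma fibSS m x : fib m.+2 x = x * fib m.+1 x + fib m x.
Proof. by rewrite /= hornerD hornerM hornerX. Qed.

Lemma fib0 x : fib 0 x = 0. Proof. exact: horner0. Qed.
Lemma fib1 x : fib 1 x = 1. Proof. exact: hornerC. Qed.

Lemma fib_add p q x :
  fib (p + q).+1 x = fib p.+1 x * fib q.+1 x + fib p x * fib q x.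
Proof.
suff: fib (p + q).+1 x = fib p.+1 x * fib q.+1 x + fib p x * fib q x /\
      fib (p + q).+2 x = fib p.+2 x * fib q.+1 x + fib p.+1 x * fib q x by case.
elim: p => [|p [IH1 IH2]]; last first.
  by split; rewrite ?addSn // fibSS IH1 IH2 !(fibSS p.+1) (fibSS p); ring.
by rewrite !add0n !fibSS fib0 fib1; split; ring.
Qed.

Lemma fib_oppr m x : fib m (- x) = (-1) ^+ m.+1 * fib m x.
Proof.
suff: fib m (- x) = (-1) ^+ m.+1 * fib m x /\
      fib m.+1 (- x) = (-1) ^+ m.+2 * fib m.+1 x by case.
elim: m => [|m [IH1 IH2]]; first by rewrite !fib0 !fib1; split; ring.
by split=> //; rewrite !fibSS IH1 IH2 !exprS; ring.
Qed.

Lemma fib_cassini m x :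
  fib m.+1 x ^+ 2 - x * fib m x * fib m.+1 x - fib m x ^+ 2 = (-1) ^+ m.
Proof.
elim: m => [|m IH]; first by rewrite fib0 fib1; ring.
by rewrite [RHS]exprS -IH fibSS; ring.
Qed.

(** The companion matrix of the recurrence, raised to the power N, is the
identity exactly when F_N = 0 and F_{N+1} = 1; [fibA] and [fibC] measure the
deviation from this. *)
Definition fibA m (x : Z2) : Z2 := fib m x.
Definition fibC m (x : Z2) : Z2 := fib m.+1 x - 1.

Lemma fibA_add p q x : fibA (p + q) x =
  (1 + fibC p x) * fibA q x + fibA p x * (1 + fibC q x - x * fibA q x).
Proof.
rewrite /fibA /fibC !(addrC 1) !subrK; case: q => [|q].
  by rewrite addn0 fib0 fib1; ring.
by rewrite addnS fib_add fibSS; ring.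
Qed.

Lemma fibC_add p q x : fibC (p + q) x =
  fibC p x + fibC q x + fibC p x * fibC q x + fibA p x * fibA q x.
Proof. by rewrite /fibA /fibC fib_add; ring. Qed.

(** The polynomials themselves need not be small coefficientwise: only their
values and difference quotients on Z_2 are. *)
Definition near_id i N := flat i (fibA N) /\ flat i (fibC N).

Lemma near_idW i j N : (j <= i)%N -> near_id i N -> near_id j N.
Proof. by move=> ji [A C]; split; apply: flatW ji _. Qed.

Lemma near_id_add i p q : near_id i p -> near_id i q -> near_id i (p + q).
Proof.
move=> [Ap Cp] [Aq Cq]; split.
  apply: (@flat_ext _ (fun x => fibA q x + fibC p x * fibA q x +
                      (fibA p x + fibA p x * fibC q x - fibA p x * (x * fibA q x)))).
    by move=> x /=; rewrite fibA_add; ring.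
  apply: flatD; first by apply: flatD => //; apply: flatMl => //; apply: flatW Cp.
  apply: flatB; first by apply: flatD => //; apply: flatMl => //; apply: flatW Ap.
  apply: flatMl; first exact: flatW Ap.
  by apply: flatMl => //; exact: flat_id.
apply: (@flat_ext _ (fun x => fibC p x + fibC q x + fibC p x * fibC q x +
                       fibA p x * fibA q x)).
  by move=> x; rewrite fibC_add.
apply: flatD; first apply: flatD; first exact: flatD.
- by apply: flatMl => //; apply: flatW Cp.
- by apply: flatMl => //; apply: flatW Ap.
Qed.

(** F_2N = 2 F_N + terms of degree at least 2 in the small quantities a and c,
and similarly for F_{2N+1} - 1; for i > 0 the quadratic terms already lie in
level 2i, which is at least i + 1. *)
Lemma near_id_double i N : (0 < i)%N -> near_id i N -> near_id i.+1 (N + N).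
Proof.
move=> i0 [AN CN]; have ii : (i.+1 <= i + i)%N by lia.
split.
  apply: (@flat_ext _ (fun x => 2 * fibA N x + 2 * (fibC N x * fibA N x) -
                         x * (fibA N x * fibA N x))).
    by move=> x; rewrite fibA_add; ring.
  apply: flatB; first apply: flatD; first exact: flat2.
  - by apply/flat2/flatMl => //; apply: flatW CN.
  - by apply: flatMl; [exact: flat_id|exact: flatW (flatM AN AN)].
apply: (@flat_ext _ (fun x => 2 * fibC N x + fibC N x * fibC N x +
                       fibA N x * fibA N x)).
  by move=> x; rewrite fibC_add; ring.
apply: flatD; first apply: flatD; first exact: flat2.
- exact: flatW (flatM CN CN).
- exact: flatW (flatM AN AN).
Qed.

Lemma near_id_mul i N w : near_id i N -> near_id i (w * N).
Proof.
move=> nN; elim: w => [|w IH]; last by rewrite mulSn; exact: near_id_add.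
have flat_zero : flat i (fun=> 0) by have := flat_cst i 0; rewrite mulr0.
split; apply: flat_ext flat_zero => x.
  by rewrite /fibA fib0.
by rewrite /fibC fib1 subrr.
Qed.

Lemma near_id_even N x : near_id 1 N ->
  (exists a, fibA N x = 2 * a) /\ (exists c, fibC N x = 2 * c).
Proof.
by move=> [[/(_ x)[a ->] _] [/(_ x)[c ->] _]]; split; [exists a|exists c].
Qed.

(** F_2N = F_N (2 + 2c - x F_N), where the second factor is 2 modulo 4; the
assumption k >= 2 makes x F_N vanish modulo 4. *)
Lemma fibA_double_val k N x :
  near_id 1 N -> (2 <= k)%N -> val2 k (fibA N x) -> val2 k.+1 (fibA (N + N) x).
Proof.
move=> /(near_id_even x)[_ [c Ce]] k2 vA.
have -> : fibA (N + N) x = fibA N x * (2 + (4 * c - x * fibA N x)).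
  by rewrite fibA_add Ce; ring.
rewrite -addn1; apply: val2M => //; apply: (@val2D _ 2) => //.
  by exists 0; ring.
apply: dvd2B; first by exists c; ring.
by rewrite mulrC; apply/dvd2Ml/(dvd2W k2)/val2_dvd2.
Qed.

(** F_{wN} is F_N times a cofactor congruent to w modulo 2. *)
Lemma fibA_mul_odd_val k N w x :
  near_id 1 N -> val2 k (fibA N x) -> val2 k (fibA ((1 + 2 * w) * N) x).
Proof.
move=> nN vA.
suff [z ->] : exists z,
    fibA ((1 + 2 * w) * N) x = fibA N x * ((1 + 2 * w)%:R + 2 * z).
  rewrite -(addn0 k); apply: val2M => //; exists (w%:R + z).
  by rewrite natrD natrM; ring.
have [[a Ae] [c Ce]] := near_id_even x nN.
elim: (1 + 2 * w)%N => [|v [z IH]].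
  by exists 0; rewrite /fibA fib0; ring.
have [_ [c' Ce']] := near_id_even x (near_id_mul v nN).
exists (z + c' + (v%:R + 2 * z) * (c - x * a)).
rewrite mulSn addnC fibA_add Ce' Ce IH -natr1 [in x * _]Ae; ring.
Qed.

Lemma fibA_12 x : fibA 12 x =
  x * (x ^+ 2 + 1) * (x ^+ 2 + 2) * (x ^+ 2 + 3) * (x ^+ 4 + 4 * x ^+ 2 + 1).
Proof. by rewrite /fibA !fibSS fib0 fib1; ring. Qed.

Lemma fibC_12 x : fibC 12 x = fibA 6 x ^+ 2 + fibC 6 x * (fibC 6 x + 2).
Proof. by rewrite (fibC_add 6 6); ring. Qed.

Lemma fibC_6 x : fibC 6 x = x ^+ 2 * (x ^+ 2 + 2) * (x ^+ 2 + 3).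
Proof. by rewrite /fibC !fibSS fib0 fib1; ring. Qed.

Lemma fibA_6 x : fibA 6 x = x * (x ^+ 2 + 1) * (x ^+ 2 + 3).
Proof. by rewrite /fibA !fibSS fib0 fib1; ring. Qed.

(** Both functions are combinations of x^2 (x^2 + 1) and of the constant 2, with
1-Lipschitz coefficients.  The index 6 would not do, since F_6 is only
1-Lipschitz on even numbers. *)
Lemma near_id_12 : near_id 1 12.
Proof.
have fsq := flat0_sqD; have fp := flat_sq_pronic; split.
  apply: (@flat_ext _ (fun x => (x * (x ^+ 2 + 3) * (x ^+ 4 + 4 * x ^+ 2 + 1)) *
     (x ^+ 2 * (x ^+ 2 + 1) + 2 * (x ^+ 2 + 1)))).
    by move=> x; rewrite fibA_12; ring.
  apply: flatMl; last by apply: flatD => //; apply: flat2.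
  apply: (@flatMl 0); first by apply: (@flatMl 0) => //; exact: flat_id.
  apply: (@flat_ext _ (fun x => (x ^+ 2 + 2) * (x ^+ 2 + 2) + - 3)).
    by move=> x; ring.
  by apply: flatD; [exact: flatMl|exact: flat0_cst].
have fC : flat 1 (fibC 6).
  apply: (@flat_ext _ (fun x => (x ^+ 2 + 4) * (x ^+ 2 * (x ^+ 2 + 1)) +
                         2 * (x ^+ 2 + 0))).
    by move=> x; rewrite fibC_6; ring.
  by apply: flatD; [exact: flatMl|exact: flat2].
apply: (@flat_ext _ (fun x => ((x ^+ 2 + 1) * ((x ^+ 2 + 3) * (x ^+ 2 + 3))) *
   (x ^+ 2 * (x ^+ 2 + 1)) + (fibC 6 x + 2) * fibC 6 x)).
  by move=> x; rewrite fibC_12 fibA_6; ring.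
apply: flatD; apply: flatMl => //.
  by apply: (@flatMl 0) => //; apply: (@flatMl 0).
by apply: flatD; [exact: flatW fC|exact: flat0_cst].
Qed.

(** Valuation of F_12 at a point of valuation n; the jump at n = 0 is due to
the factors x^2 + 1, x^2 + 3 and x^4 + 4x^2 + 1, which are even at odd x. *)
Definition fib12_exponent (n : nat) : nat := if n == 0%N then 4 else n.+1.

Lemma fibA_12_val n x : val2 n x -> val2 (fib12_exponent n) (fibA 12 x).
Proof.
rewrite fibA_12 /fib12_exponent; case: n => [|n] vx /=.
  have [y xy] : exists y, x = 1 + 2 * y.
    by have [y ->] := vx; exists y; rewrite mul1r.
  (* For odd x, x^2 = 1 modulo 8, which fixes the valuation of every factor. *)
  have [z yz] : exists z, y ^+ 2 + y = 2 * z.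
    case: (Z2_parity y) => e [->|->]; first by exists (2 * e ^+ 2 + e); ring.
    by exists (2 * e ^+ 2 + 3 * e + 1); ring.
  have x2 : x ^+ 2 = 1 + 8 * z 
    by rewrite (_ : 8 * z = 4 * (2 * z)); [rewrite -yz xy; ring|ring].
  rewrite (exprM x 2 2) x2.
  apply: (@val2M 3 1); first apply: (@val2M 1 2); first apply: (@val2M 1 0);
    first apply: (@val2M 0 1) => //.
  - by exists (2 * z); ring.
  - by exists (1 + 4 * z); ring.
  - by exists z; ring.
  - by exists (1 + 12 * z + 16 * z ^+ 2); ring.
have [y xy] : exists y, x = 2 * y.
  by have [y ->] := val2_dvd2 vx; exists (2 ^+ n * y); rewrite exprS mulrA.
have -> : n.+2 = (n.+1 + 0 + 1 + 0 + 0)%N by rewrite !addn0 addn1.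
apply: val2M; first apply: val2M; first apply: val2M; first apply: val2M => //.
- by exists (2 * y ^+ 2); rewrite xy; ring.
- by exists (y ^+ 2); rewrite xy; ring.
- by exists (1 + 2 * y ^+ 2); rewrite xy; ring.
- by exists (8 * y ^+ 4 + 8 * y ^+ 2); rewrite xy; ring.
Qed.
(** * Maps that drift by a fixed valuation *)

Record drifting (S : set Z2) (K : nat) (g : Z2 -> Z2) : Prop := Drifting {
  drift_stable : forall x, S x -> S (g x);
  drift_lip : forall x y, S x -> S y ->
    exists w, (g x - x) - (g y - y) = 4 * (x - y) * w;
  drift_val : forall x, S x -> val2 K (g x - x)
}.

(** g(g(x)) - x is twice g(x) - x, plus the variation of g - id between x and
g(x), which is divisible by 4 (g(x) - x). *)
Lemma drifting_double S K g : drifting S K g -> drifting S K.+1 (fun x => g (g x)).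
Proof.
move=> [st lip vl]; split=> [x Sx|x y Sx Sy|x Sx]; first exact/st/st.
  have [[w e] [w' e']] := (lip _ _ Sx Sy, lip _ _ (st _ Sx) (st _ Sy)).
  exists (w + (1 + 4 * w) * w').
  have gxy : g x - g y = (x - y) * (1 + 4 * w).
    have -> : g x - g y = (x - y) + (g x - x - (g y - y)) by ring.
    by rewrite e; ring.
  rewrite gxy in e'.
  have -> : g (g x) - x - (g (g y) - y) =
    (g x - x - (g y - y)) + (g (g x) - g x - (g (g y) - g y)) by ring.
  by rewrite e e'; ring.
have [w e] := lip _ _ (st _ Sx) Sx.
rewrite (_ : g (g x) - x = (g x - x) * (2 + 4 * w)).
  by rewrite -addn1; apply: val2M; [exact: vl|exists w; ring].
have -> : g (g x) - x = (g (g x) - g x - (g x - x)) + 2 * (g x - x) by ring.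
by rewrite e; ring.
Qed.

Lemma iter_comp2 n (g : Z2 -> Z2) x :
  iter n (fun x => g (g x)) x = iter (2 * n) g x.
Proof. by elim: n => // n IH; rewrite mulnS /= IH. Qed.

Lemma drifting_iter S K g n x : drifting S K g -> S x ->
  S (iter n g x) /\ dvd2 K (iter n g x - x).
Proof.
move=> gS Sx; elim: n => [|n [IH1 IH2]] /=.
  by split=> //; exists 0; rewrite subrr mulr0.
split; first exact: (drift_stable gS).
exact: dvd2_trans (val2_dvd2 (drift_val gS IH1)) IH2.
Qed.

(** Replacing g by g o g and halving n, one may assume n odd; then the first
n - 1 steps move x by a multiple of 2^(K+1), which the last step, of valuation K,
cannot undo. *)
Lemma drifting_aperiodic S K g n x :
  drifting S K g -> S x -> (0 < n)%N -> iter n g x <> x.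
Proof.
elim/ltn_ind: n K g => n IH K g gS Sx n0.
have := odd_double_half n; rewrite -mul2n.
case: (odd n) => /= [|] nE; last first.
  rewrite -nE -iter_comp2; apply: (IH _ _ _ _ (drifting_double gS)) => //; lia.
have [Sy yx] := drifting_iter n./2 (drifting_double gS) Sx.
rewrite -nE /= => e.
move: (drift_val gS Sy) yx; rewrite iter_comp2 e => vx /dvd2_sym.
exact: val2_ndvd2 vx.
Qed.

(** If x and y differ at the digit of index K, one step of g corrects this digit
because the drift has valuation K; from then on g o g, which leaves the digit
alone, corrects the next one. *)
Lemma drifting_reach S K g x y j : drifting S K g -> S x -> dvd2 K (y - x) ->
  exists n, dvd2 (K + j) (y - iter n g x).
Proof.
elim: j K g x => [|j IH] K g x gS Sx xy; first by exists 0%N; rewrite addn0.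
have gS2 := drifting_double gS.
rewrite addnS -addSn; have [xy'|xy'] := dvd2_stepP xy.
  by have [n] := IH _ _ _ gS2 Sx xy'; rewrite iter_comp2 => ?; exists (2 * n)%N.
have [] := IH _ _ (g x) gS2 (drift_stable gS Sx).
  rewrite -(subrKA x) -opprB (_ : x - g x = - (g x - x)) ?opprB //.
  by apply: val2D_same; rewrite ?opprB // -opprB; apply/val2N/(drift_val gS).
by move=> n; rewrite iter_comp2 -iterSr => ?; exists (2 * n).+1.
Qed.

(** * Cosets and the 2-adic topology *)

Lemma coset2P c k y : coset2 c k y <-> dvd2 k (y - c).
Proof.
split=> [[z _ <-]|[z e]]; first by exists z; rewrite addrC addKr.
by exists z => //; rewrite -e addrC subrK.
Qed.

Lemma Z2dist_le x y k : (Z2dist x y <= 2 ^- k) <-> dvd2 k (x - y).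
Proof. by rewrite dvd2P /Z2dist Z2abs_le; split=> /eqP. Qed.

Lemma ballE (x : Z2) (e : rat) y : ball x e y = (Z2dist x y < e).
Proof. by []. Qed.

(** Balls are defined by a strict inequality and the absolute value takes only
powers of 2 as nonzero values, so the radius is twice 2^-k. *)
Lemma coset2_ball c k : coset2 c k = ball c (2 * 2 ^- k : rat).
Proof.
rewrite predeqE => y; rewrite coset2P ballE.
suff -> : (Z2dist c y < 2 * 2 ^- k) = (Z2dist c y <= 2 ^- k).
  by split=> [/dvd2_sym/Z2dist_le|/Z2dist_le/dvd2_sym].
rewrite /Z2dist; have [->|[v ->]] := Z2absP (c - y).
  by rewrite invr_ge0 exprn_ge0 // mulr_gt0 ?invr_gt0 ?exprn_gt0.
rewrite lef_pV2 ?posrE ?exprn_gt0 // ler_eXn2l // -ltnS.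
by rewrite ltr_pdivlMr ?exprn_gt0 // ltr_pdivrMl ?exprn_gt0 // -exprSr ltr_eXn2l.
Qed.

Lemma small_exp2 (e : rat) : 0 < e -> exists k, 2 * 2 ^- k < e.
Proof.
move=> e0; exists (Num.bound (2 / e)).
have := upper_nthrootP (leqnn (Num.bound (2 / e))).
by rewrite ltr_pdivrMr // ltr_pdivrMr ?exprn_gt0 // mulrC.
Qed.

Lemma coset2_center c k : coset2 c k c.
Proof. by apply/coset2P; exists 0; rewrite subrr mulr0. Qed.

Lemma coset2_nbhs c k : nbhs c (coset2 c k).
Proof.
apply/nbhs_ballP; exists (2 * 2 ^- k : rat); last by rewrite -coset2_ball.
by rewrite /= mulr_gt0 ?invr_gt0 ?exprn_gt0.
Qed.

Lemma coset2_eq c d k : dvd2 k (c - d) -> coset2 c k = coset2 d k.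
Proof.
move=> cd; rewrite predeqE => y; rewrite !coset2P.
by split=> ?; [apply: dvd2_trans cd|apply: dvd2_trans (dvd2_sym cd)].
Qed.

Lemma coset2_open c k : open (coset2 c k).
Proof.
rewrite openE => y /coset2P/coset2_eq <-; exact: coset2_nbhs.
Qed.

Lemma coset2_closed c k : closed (coset2 c k).
Proof.
move=> y /(_ _ (coset2_nbhs y k))[z [/coset2P zc /coset2P zy]].
by apply/coset2P; apply: dvd2_trans (dvd2_sym zy) zc.
Qed.

Lemma closure_dvd2 (A : set Z2) y :
  (forall k, exists2 x, A x & dvd2 k (y - x)) -> closure A y.
Proof.
move=> Ay B /nbhs_ballP[e /= e0 eB]; have [k ke] := small_exp2 e0.
have [x Ax yx] := Ay k; exists x; split=> //; apply: eB.
by apply: (le_ball (ltW ke)); rewrite -coset2_ball; apply/coset2P/dvd2_sym.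
Qed.

(** * Odd maps close to the negation *)

(** The shape of the components: negation composed with a translation by
2^(K-1) exchanges the two cosets. *)
Definition pair_of_cosets (c : Z2) (K : nat) : set Z2 :=
  coset2 c K `|` coset2 (2 ^+ K.-1 - c) K.

(** Throughout the section f(x) + x is small, of a valuation (K n) - 1 that
depends only on the valuation n of x. *)
Section Reflection.
Variables (f : Z2 -> Z2) (K : nat -> nat).
Hypothesis K_gt : forall n, (n.+1 < K n)%N.
Hypothesis f_odd : forall x, f (- x) = - f x.
Hypothesis f_flat : flat 2 (fun x => f x + x).
Hypothesis f_val : forall n x, val2 n x -> val2 (K n).-1 (f x + x).

Lemma f_lip x y z : x = y + 2 * z ->
  exists w, f x + x - (f y + y) = 4 * (x - y) * w.
Proof.
move=> ->; have [_ /(_ y z)[w ->]] := f_flat; exists w.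
by rewrite (_ : y + 2 * z - y = 2 * z); ring.
Qed.

Lemma val2_parity n x y : val2 n x -> val2 n y -> exists z, x = y + 2 * z.
Proof.
move=> [a ->] [b ->]; exists (2 ^+ n * (a - b)); ring.
Qed.

Lemma f_stable n x : val2 n x -> val2 n (f x).
Proof.
move=> vx; rewrite -(addrK x (f x)) addrC; apply: (@val2D _ (K n).-1).
- by have := K_gt n; lia.
- exact: val2N.
- exact/val2_dvd2/f_val.
Qed.

Lemma f_zero : f 0 = 0.
Proof.
apply: mul2_eq0; have := f_odd 0; rewrite oppr0 => e.
by rewrite (_ : 2 * f 0 = f 0 - - f 0); [rewrite -e subrr|ring].
Qed.

(** With h(x) = f(x) + x and f odd, f(f(x)) - x = h(f(x)) - h(-x) - 2 h(x), and
the first difference is divisible by 4 h(x) since f(x) and -x differ by h(x).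
So the valuation is one more than that of h(x). *)
Lemma f_drifting n : drifting (val2 n) (K n) (fun x => f (f x)).
Proof.
split=> [x vx|x y vx vy|x vx]; first exact/f_stable/f_stable.
  have [z xy] := val2_parity vx vy.
  have [z' fxy] := val2_parity (f_stable vx) (f_stable vy).
  have [[w e] [w' e']] := (f_lip xy, f_lip fxy).
  have fxfy : f x - f y = - (x - y) * (1 - 4 * w).
    have -> : f x - f y = (f x + x - (f y + y)) - (x - y) by ring.
    by rewrite e; ring.
  exists (- (1 - 4 * w) * w' - w); rewrite fxfy in e'.
  have -> : f (f x) - x - (f (f y) - y) = (f (f x) + f x - (f (f y) + f y)) -
     (f x + x - (f y + y)) by ring.
  by rewrite e e'; ring.
have hx := f_val vx; have := K_gt n.
have [c hc] : exists c, f x + x = 2 * c.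
  have [f_even _] := f_flat; have [c ->] := f_even x; exists (2 * c); ring.
have [|w] := @f_lip (f x) (- x) c; first by rewrite -hc; ring.
rewrite f_odd => e Kn.
have -> : f (f x) - x = (f x + x) * (- 2 + 4 * w).
  have -> : f (f x) - x = f (f x) + f x - (- f x + - x) - 2 * (f x + x) by ring.
  by rewrite e; ring.
have -> : K n = ((K n).-1 + 1)%N by lia.
by apply: val2M => //; exists (w - 1); ring.
Qed.

Lemma f_aperiodic n x k : val2 n x -> (0 < k)%N -> iter k f x <> x.
Proof.
move=> vx k0 e; apply: (drifting_aperiodic (n := k) (f_drifting n) vx k0).
by rewrite iter_comp2 mul2n -addnn iterD !e.
Qed.

Lemma f_periodic x : periodic_point f x <-> x = 0.
Proof.
split=> [[k k0 e]|->]; last by exists 1%N => //=; exact: f_zero.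
have [//|/eqP/val2_ex[n vx]] := eqVneq x 0.
by case: (f_aperiodic vx k0 e).
Qed.

Lemma f_image n x : val2 n x -> dvd2 (K n) (f x - (2 ^+ (K n).-1 - x)).
Proof.
move=> vx; rewrite (_ : _ - _ = (f x + x) + - 2 ^+ (K n).-1); last by ring.
rewrite -[X in dvd2 X _](@prednK (K n)); last by have := K_gt n; lia.
apply: val2D_same; first exact: f_val.
by apply: val2N; exists 0; ring.
Qed.

Lemma pair_of_cosets_val n c x : val2 n c -> pair_of_cosets c (K n) x -> val2 n x.
Proof.
move=> vc; have nK := K_gt n; case=> /coset2P xc.
  by rewrite -(subrK c x) addrC; apply: val2D xc => //; lia.
rewrite -(subrK (2 ^+ (K n).-1 - c) x) addrC; apply: val2D xc; first by lia.
rewrite addrC; apply: (@val2D _ (K n).-1); [lia|exact: val2N|].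
by exists 1; rewrite mulr1.
Qed.

(** The pair of cosets is the orbit of any of its points modulo 2^k under the
involution c |-> 2^(k-1) - c. *)
Lemma pair_of_cosets_eq c x k : (0 < k)%N -> pair_of_cosets c k x ->
  pair_of_cosets x k = pair_of_cosets c k.
Proof.
rewrite /pair_of_cosets => k0; case=> /coset2P xc.
  rewrite (coset2_eq xc) (@coset2_eq (2 ^+ k.-1 - x) (2 ^+ k.-1 - c)) //.
  by apply: dvd2_sym; rewrite (_ : _ - _ = x - c); [|ring].
rewrite (coset2_eq xc) setUC (@coset2_eq (2 ^+ k.-1 - x) c) //.
apply: dvd2_sym; rewrite (_ : _ - _ = x - (2 ^+ k.-1 - c)) //; ring.
Qed.

(** Even iterates are dense in the coset of the starting point, and one
application of f leads into the other coset. *)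
Lemma pair_of_cosets_minimal n c : val2 n c ->
  minimal_component f (pair_of_cosets c (K n)).
Proof.
move=> vc; have nK := K_gt n; split.
- by exists c; left; exact: coset2_center.
- by split; [apply: openU; exact: coset2_open|apply: closedU; exact: coset2_closed].
- exists [:: (c, 2 * 2 ^- K n); (2 ^+ (K n).-1 - c, 2 * 2 ^- K n)]; split.
    by move=> b; rewrite !inE => /orP[] /eqP -> /=; rewrite mulr_gt0 ?invr_gt0 ?exprn_gt0.
  rewrite /pair_of_cosets !coset2_ball predeqE => y; split.
    case=> yB; first by exists (c, 2 * 2 ^- K n) => //=; rewrite !inE eqxx.
    by exists (2 ^+ (K n).-1 - c, 2 * 2 ^- K n) => //=; rewrite !inE eqxx orbT.
  by move=> [b /=]; rewrite !inE => /orP[]/eqP -> ?; [left|right].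
- move=> _ [x cx <-]; rewrite -(pair_of_cosets_eq _ cx); last by lia.
  by right; apply/coset2P/f_image/(pair_of_cosets_val vc).
move=> x cx y; rewrite -(pair_of_cosets_eq _ cx); last by lia.
have vx := pair_of_cosets_val vc cx.
suff reach z j : val2 n z -> dvd2 (K n) (y - z) -> exists i, dvd2 j (y - iter i f z).
  case=> /coset2P yx; apply: closure_dvd2 => j.
    by have [i ?] := reach x j vx yx; exists (iter i f x) => //; exists i.
  have [|i ?] := reach (f x) j (f_stable vx).
    exact: dvd2_trans yx (dvd2_sym (f_image vx)).
  by exists (iter i f (f x)) => //; exists i.+1 => //; rewrite iterSr.
move=> vz yz; have [i] := drifting_reach j (f_drifting n) vz yz.
by move=> /(dvd2W (leq_addl _ _)); rewrite iter_comp2 => ?; exists (2 * i)%N.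
Qed.

(** A minimal component is open, hence contains a nonzero point c.  The closure
of the orbit of c lies in every closed invariant set through c, and it fills
both the component and the pair of cosets of c. *)
Lemma minimal_component_pair S : minimal_component f S ->
  exists n c, val2 n c /\ S = pair_of_cosets c (K n).
Proof.
move=> [[x Sx] [oS cS] _ fS mS].
have [n [c [Sc vc]]] : exists n c, S c /\ val2 n c.
  have [x0|/eqP/val2_ex[n vx]] := eqVneq x 0; last by exists n, x.
  have /nbhs_ballP[e /= e0 eS] : nbhs x S by exact: open_nbhs_nbhs.
  have [k ke] := small_exp2 e0; exists k, (2 ^+ k); split; last by exists 0; ring.
  apply: eS; apply: (le_ball (ltW ke)); rewrite -coset2_ball x0.
  by apply/coset2P; exists 1; ring.
exists n, c; split=> //; have [[z zC] [oC cC] _ fC mC] := pair_of_cosets_minimal vc.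
have Cc : pair_of_cosets c (K n) c by left; exact: coset2_center.
have orbit_sub (B : set Z2) : closed B -> f @` B `<=` B -> B c ->
    closure (forward_orbit f c) `<=` B.
  move=> cB fB Bc; apply: subset_trans cB; apply: closureS => _ [i _ <-].
  by elim: i => //= i IH; apply: fB; exists (iter i f c).
rewrite eqEsubset; split.
  exact: subset_trans (mS _ Sc) (orbit_sub _ cC fC Cc).
exact: subset_trans (mC _ Cc) (orbit_sub _ cS fS Sc).
Qed.

End Reflection.
(** * The polynomial F_m as a perturbation of the negation *)

Lemma near_id_12_exp t : near_id t.+1 (12 * 2 ^ t).
Proof.
elim: t => [|t IH]; first exact: near_id_12.
by rewrite expnS mulnCA mul2n -addnn; exact: near_id_double.
Qed.

Lemma fibA_12_exp_val t n x : val2 n x ->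
  val2 (fib12_exponent n + t) (fibA (12 * 2 ^ t) x).
Proof.
move=> vx; elim: t => [|t IH]; first by rewrite addn0; exact: fibA_12_val.
rewrite expnS mulnCA mul2n -addnn addnS; apply: fibA_double_val => //.
  exact: near_idW (near_id_12_exp t).
by rewrite /fib12_exponent; case: eqP; lia.
Qed.

(** The points of valuation n form 2^(level u n) components, and each of these
consists of two cosets of 2^(radius u n) Z_2.  Of the digits that determine a
coset, the first n + 2 give the valuation and the class modulo 4 of the unit
part, and this class differs between the two cosets of a component. *)
Definition level (u n : nat) : nat := if n == 0%N then u.+2 else u.
Definition radius (u n : nat) : nat := n.+2 + level u n.

Section Fibonacci.
Variables (u r m : nat).
Hypothesis u_ge2 : (2 <= u)%N.
Hypothesis mE : m.+2 = ((1 + 2 * r) * (12 * 2 ^ u))%N.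

Let near_id_m : near_id 3 m.+2.
Proof.
by rewrite mE; apply: near_id_mul; apply: near_idW (near_id_12_exp u).
Qed.

Lemma fib_even : ~~ odd m.
Proof.
have : ~~ odd m.+2 by rewrite mE !oddM andbF.
by rewrite /= negbK.
Qed.

Lemma fib_odd x : fib m (- x) = - fib m x.
Proof. by rewrite fib_oppr -signr_odd /= fib_even mulN1r. Qed.

Lemma fib_plus_id x : fib m x + x = (1 + x ^+ 2) * fibA m.+2 x - x * fibC m.+2 x.
Proof. by rewrite /fibA /fibC !fibSS; ring. Qed.

Lemma fib_flat : flat 2 (fun x => fib m x + x).
Proof.
have [A C] := near_idW (isT : (2 <= 3)%N) near_id_m.
apply: (@flat_ext _ (fun x => (x ^+ 2 + 1) * fibA m.+2 x - x * fibC m.+2 x)).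
  by move=> x; rewrite fib_plus_id; ring.
apply: flatB; apply: flatMl => //; [exact: flat0_sqD|exact: flat_id].
Qed.

(** Cassini's identity reads c (2 + c - x a) = a (a + x), which replaces c by a
in h = (1 + x^2) a - x c. *)
Lemma fib_cassini_plus_id x :
  (fib m x + x) * (2 + fibC m.+2 x - x * fibA m.+2 x) =
  fibA m.+2 x * (2 + x ^+ 2 + (fibC m.+2 x * (1 + x ^+ 2) - 2 * x * fibA m.+2 x -
                                 x ^+ 3 * fibA m.+2 x)).
Proof.
have : (1 + fibC m.+2 x) ^+ 2 - x * fibA m.+2 x * (1 + fibC m.+2 x) -
    fibA m.+2 x ^+ 2 = 1.
  rewrite /fibA /fibC (addrC 1) subrK fib_cassini.
  by rewrite -signr_odd /= negbK (negbTE fib_even).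
rewrite fib_plus_id; move: (fibA _ x) (fibC _ x) => a c e.
have {}e : c * (2 + c - x * a) = a * (a + x).
  have -> : c * (2 + c - x * a) = ((1 + c) ^+ 2 - x * a * (1 + c) - a ^+ 2) +
     (a ^+ 2 + x * a - 1) by ring.
  by rewrite e; ring.
have -> : ((1 + x ^+ 2) * a - x * c) * (2 + c - x * a) =
  (1 + x ^+ 2) * a * (2 + c - x * a) - x * (c * (2 + c - x * a)) by ring.
by rewrite e; ring.
Qed.

(** The factor 2 + c - x a has valuation 1, and the cofactor of a on the right
is congruent to 2 + x^2 modulo 4: odd for odd x, of valuation 1 for even x. *)
Lemma fib_val n x : val2 n x -> val2 (radius u n).-1 (fib m x + x).
Proof.
move=> vx; have [[vA _] [vC _]] := near_idW (isT : (2 <= 3)%N) near_id_m.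
apply: (@val2_cancel 1 _ _ (2 + fibC m.+2 x - x * fibA m.+2 x)).
  rewrite -addrA; apply: (@val2D _ 2) => //; first by exists 0; ring.
  by apply: dvd2B => //; rewrite mulrC; apply: dvd2Ml.
rewrite fib_cassini_plus_id.
have vAn : val2 (fib12_exponent n + u) (fibA m.+2 x).
  rewrite mE; apply: fibA_mul_odd_val; last exact: fibA_12_exp_val.
  exact: near_idW (near_id_12_exp u).
have rest : dvd2 2 (fibC m.+2 x * (1 + x ^+ 2) - 2 * x * fibA m.+2 x -
                    x ^+ 3 * fibA m.+2 x).
  by apply: dvd2B; [apply: dvd2B|]; rewrite 1?(mulrC _ (fibA _ x)); apply: dvd2Ml.
have -> : ((radius u n).-1 + 1 = fib12_exponent n + u + (n != 0))%N.
  by rewrite /radius /level /fib12_exponent; case: n {vx vAn} => [|n] /=; lia.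
apply: val2M => //; apply: val2D rest; first by case: n {vx vAn}.
case: n vx {vAn} => [|n] /= vx; last first.
  have [y ->] := val2_dvd2 vx; exists (2 ^+ n.*2 * y ^+ 2).
  by rewrite exprMn -exprM exprS (_ : (n.+1 * 2 = n.*2.+2)%N) ?muln2 // !exprS; ring.
have [y ->] := vx; exists (1 + 2 * y + 2 * y ^+ 2); ring.
Qed.

End Fibonacci.

Lemma radius_gt u n : (0 < u)%N -> (n.+2 < radius u n)%N.
Proof. by rewrite /radius /level; case: n => [|n] /=; lia. Qed.

(** * The components as pairs of cosets *)

Definition index_val (i : nat + nat * nat) : nat :=
  match i with inl _ => 0 | inr (n, _) => n end.
Definition index_num (i : nat + nat * nat) : nat :=
  match i with inl k => k | inr (_, k) => k end.
Definition center (n k : nat) : Z2 := (1 + 4 * k%:R) * 2 ^+ n.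

Lemma center_val n k : val2 n (center n k).
Proof. by exists (2 * k%:R); rewrite /center; ring. Qed.

Lemma setA_pair u k : setA u k = pair_of_cosets (center 0 k) (radius u 0).
Proof.
rewrite /setA /pair_of_cosets /center mulr1.
rewrite (_ : radius u 0 = (u + 4)%N); last by rewrite /radius /level /=; lia.
by rewrite (_ : (u + 4).-1 = (u + 3)%N) ?opprD ?addrA // !addnS.
Qed.

Lemma setM_pair u n k : (0 < n)%N ->
  setM u n k = pair_of_cosets (center n k) (radius u n).
Proof.
case: n => // n _; rewrite /setM /pair_of_cosets /center.
rewrite (_ : radius u n.+1 = (n.+1 + u + 2)%N); last by rewrite /radius /level /=; lia.
rewrite (_ : (n.+1 + u + 2).-1 = (u + 1 + n.+1)%N); last by lia.
by rewrite (exprD _ (u + 1) n.+1) -mulrBl opprD addrA.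
Qed.

Lemma component_pair u i : index_AM u i -> component_AM u i =
  pair_of_cosets (center (index_val i) (index_num i)) (radius u (index_val i)).
Proof.
by case: i => [k|[n k]] /= => [_|[n0 _]]; [exact: setA_pair|exact: setM_pair].
Qed.

Lemma index_num_lt u i : index_AM u i -> (index_num i < 2 ^ level u (index_val i))%N.
Proof.
by case: i => [k|[[|n] k]] /= => [|[]|[]] //; rewrite addn2.
Qed.

Lemma index_inj u i j : index_AM u i -> index_AM u j ->
  index_val i = index_val j -> index_num i = index_num j -> i = j.
Proof.
case: i j => [k|[n k]] [k'|[n' k']] /= iu ju vi ki.
- by rewrite ki.
- by move: ju; rewrite -vi => -[].
- by move: iu; rewrite vi => -[].
- by rewrite vi ki.
Qed.

Lemma index_ex u n k : (k < 2 ^ level u n)%N ->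
  exists i, [/\ index_AM u i, index_val i = n & index_num i = k].
Proof.
case: n => [|n]; first by rewrite /level /= => ku; exists (inl k); split=> //=; rewrite addn2.
by move=> ku; exists (inr (n.+1, k)).
Qed.

(** If the unit part of x is 1 modulo 4, x lies in the first coset for the
number k formed by its next digits; otherwise the involution exchanging the
cosets brings x back to this case. *)
Lemma center_cover u n x : (0 < u)%N -> val2 n x ->
  exists2 k, (k < 2 ^ level u n)%N & pair_of_cosets (center n k) (radius u n) x.
Proof.
move=> u0 [y ->]; case: (Z2_parity y) => z [->|->].
  exists (res z (level u n)); first exact: res_lt.
  left; apply/coset2P; have [w e] := dvd2_res z (level u n); exists w.
  rewrite /center /radius (_ : _ - _ = 4 * 2 ^+ n * (z - (res z (level u n))%:R)).
    by rewrite e exprD !exprS; ring.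
  by ring.
set t : Z2 := 2 ^+ (level u n).-1 - 1 - z.
exists (res t (level u n)); first exact: res_lt.
right; apply/coset2P; have [w e] := dvd2_res t (level u n); exists (- w).
have l0 : (0 < level u n)%N by rewrite /level; case: eqP.
have -> : ((radius u n).-1 = n.+2 + (level u n).-1)%N by rewrite /radius; lia.
rewrite /center (_ : _ - _ = - (4 * 2 ^+ n * (t - (res t (level u n))%:R))).
  by rewrite e /radius exprD !exprS; ring.
by rewrite /t exprD !exprS; ring.
Qed.

(** Two centers are never in opposite cosets, because their unit parts are both
1 modulo 4; in the same coset, the digits of k and k' agree. *)
Lemma center_inj u n k k' : (0 < u)%N ->
  (k < 2 ^ level u n)%N -> (k' < 2 ^ level u n)%N ->
  pair_of_cosets (center n k') (radius u n) (center n k) -> k = k'.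
Proof.
move=> u0 kl kl'; have Kn := radius_gt n u0; case=> /coset2P; last first.
  have -> : center n k - (2 ^+ (radius u n).-1 - center n k') =
    2 ^+ n.+1 * (1 + 2 * (k%:R + k'%:R)) - 2 ^+ (radius u n).-1.
    by rewrite /center exprS; ring.
  move=> /val2_ndvd2; case/(_ n.+1); first exact: ltnW.
  apply: (@val2D _ (radius u n).-1); [lia|by eexists|].
  by apply: dvd2N; exists 1; rewrite mulr1.
rewrite /center /radius => -[w]; rewrite exprD -mulrA => e.
have {e}/exp2_inj e : 2 ^+ n.+2 * (k%:R - k'%:R) = 2 ^+ n.+2 * (2 ^+ level u n * w).
  by rewrite -e !exprS; ring.
have : res (k%:R : Z2) (level u n) = res (k'%:R) (level u n).
  have /dvd2P : dvd2 (level u n) (k%:R - k'%:R) by exists w.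
  move=> e0; rewrite -[in LHS](subrK (k'%:R : Z2) k%:R) resD e0 add0n.
  exact: res_id.
by rewrite !res_nat !modn_small.
Qed.

(** * The binary expansion of q *)

Lemma binary_digit_ones j r : binary_digit (2 ^ j - 1 + 2 ^ j * r) j = odd r.
Proof.
have j0 := expn_gt0 2 j; rewrite /binary_digit addnC mulnC divnMDl //.
by rewrite divn_small ?addn0 // subn1 prednK.
Qed.

Lemma u0_digits q : odd q -> exists r, q = (2 ^ u0 q - 1 + 2 ^ (u0 q).+1 * r)%N.
Proof.
move=> q_odd; rewrite /u0; case: ex_minnP => u /andP[u1 du] umin.
have ones j : (j <= u)%N -> exists r, q = (2 ^ j - 1 + 2 ^ j * r)%N.
  elim: j => [|j IH] ju; first by exists q; rewrite expn0 mul1n.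
  have [r qE] := IH (ltnW ju).
  have r_odd : odd r.
    rewrite -(binary_digit_ones j r) -qE.
    case: j ju {IH r qE} => [|j] ju; first by rewrite /binary_digit divn1.
    by apply/negPn/negP => dj; have := umin j.+1;
      rewrite dj => /(_ isT); rewrite leqNgt ju.
  exists r./2; rewrite qE -{1}(odd_double_half r) r_odd expnS -mul2n.
  have := expn_gt0 2 j; nia.
have [r qE] := ones u (leqnn u).
move: du; rewrite {1}qE binary_digit_ones => r_even.
exists r./2; rewrite {1}qE -{1}(odd_double_half r) (negbTE r_even) -mul2n expnS; lia.
Qed.

Lemma u0_gt1 q : binary_digit q 1 -> (1 < u0 q)%N.
Proof.
move=> d1; rewrite /u0; case: ex_minnP => -[|[|u]] // /andP[_].
by rewrite d1.
Qed.

Lemma sum_exp2 (u : nat) : \sum_(i < u) 2 ^+ i = 2 ^+ u - 1 :> int.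
Proof.
elim: u => [|u IH]; first by rewrite big_ord0 subrr.
by rewrite big_ord_recr /= IH exprS; ring.
Qed.

(** * The minimal decomposition *)

Theorem theorem9p6 (d : nat) :
  let q := (3 + 4 * d)%N in
  let m := (10 + 12 * q)%N in
  let u := u0 q in
  (exists r : int,
     q%:Z = \sum_(i < u) 2 ^+ i + 0 * 2 ^+ u + 2 ^+ u.+1 * r) /\
  minimal_decomposition (fibpoly Z2 m)
    [set 0]
    ((\bigcup_(k in [set k | (k < 2 ^ (u + 2))%N]) setA u k)
     `|` (\bigcup_(n in [set n | (1 <= n)%N])
            \bigcup_(k in [set k | (k < 2 ^ u)%N]) setM u n k))
    set0
    (index_AM u) (component_AM u) /\
  (fibpoly Z2 m).[0] = 0.
Proof.
move=> q m u.
have q_odd : odd q by rewrite /q oddD oddM.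
have u_gt1 : (1 < u)%N.
  apply: u0_gt1; rewrite /binary_digit /q.
  rewrite (_ : (3 + 4 * d = (1 + 2 * d) * 2 + 1)%N); last by lia.
  by rewrite divnMDl // divn_small // addn0 oddD oddM.
have [r qE] := u0_digits q_odd; rewrite -/u in qE.
have u_gt0 : (0 < u)%N := ltnW u_gt1.
have mE : m.+2 = ((1 + 2 * r) * (12 * 2 ^ u))%N.
  by rewrite /m qE expnS; have := expn_gt0 2 u; nia.
clearbody u m; pose f := horner (fibpoly Z2 m).
have K_gt n : (n.+1 < radius u n)%N := ltnW (radius_gt n u_gt0).
have f_odd : forall x, f (- x) = - f x := fib_odd mE.
have f_flat : flat 2 (fun x => f x + x) := fib_flat u_gt1 mE.
have f_val : forall n x, val2 n x -> val2 (radius u n).-1 (f x + x) :=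
  fib_val u_gt1 mE.
have cover n x : val2 n x -> exists2 i, index_AM u i & component_AM u i x.
  move=> /(center_cover u_gt0)[k /index_ex[i [iu iv ik]] xC].
  by exists i => //; rewrite component_pair // iv ik.
have compE i : index_AM u i -> forall x,
    component_AM u i x -> val2 (index_val i) x.
  move=> iu x; rewrite component_pair //.
  exact/(pair_of_cosets_val K_gt)/center_val.
have unionE : (\bigcup_(k in [set k | (k < 2 ^ (u + 2))%N]) setA u k)
     `|` (\bigcup_(n in [set n | (1 <= n)%N])
            \bigcup_(k in [set k | (k < 2 ^ u)%N]) setM u n k) =
   \bigcup_(i in index_AM u) component_AM u i.
  rewrite predeqE => x; split.
    case=> [[k ku xk]|[n n1 [k ku xk]]]; first by exists (inl k).
    by exists (inr (n, k)).
  case=> [[k|[n k]]] /= => [ku|[n1 ku]] xk; [left|right]; first by exists k.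
  by exists n => //; exists k.
have trivC : trivIset (index_AM u) (component_AM u).
  move=> i j iu ju [x [xi xj]].
  have ij := val2_uniq (compE _ iu _ xi) (compE _ ju _ xj).
  apply: (index_inj iu ju ij); apply: (@center_inj u (index_val i)) => //.
  - exact: index_num_lt.
  - by rewrite ij; apply: index_num_lt.
  - have K0 n : (0 < radius u n)%N by apply: leq_trans (K_gt n).
    rewrite component_pair // in xi; rewrite component_pair // -ij in xj.
    rewrite -(pair_of_cosets_eq (K0 _) xj) (pair_of_cosets_eq (K0 _) xi).
    by left; exact: coset2_center.
split; last split; last exact: (f_zero f_odd).
  exists r%:Z; rewrite sum_exp2 mul0r addr0 {1}qE PoszD PoszM -subzn ?expn_gt0 //.
  by rewrite -!natz !natrX !natz.
split.
- rewrite setU0 unionE predeqE => x; split=> // _.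
  have [->|/eqP/val2_ex[n vx]] := eqVneq x 0; [by left|right].
  by have [i] := cover _ _ vx; exists i.
- split; rewrite ?setI0 // unionE predeqE => x; split=> // -[/= -> [i iu]].
  by move/(compE _ iu)/val2_neq0.
- exact: finite_set1.
- by rewrite predeqE => x; rewrite /= (f_periodic K_gt f_odd f_flat f_val).
- exact: unionE.
- exact: trivC.
- exact: countableP.
- rewrite predeqE => S; split.
    case=> i iu <-; rewrite component_pair //.
    exact: (pair_of_cosets_minimal K_gt f_odd f_flat f_val (center_val _ _)).
  move/(minimal_component_pair K_gt f_odd f_flat f_val) => [n [c [vc ->]]].
  have [k /index_ex[i [iu iv ik]] cC] := center_cover u_gt0 vc.
  exists i => //; rewrite component_pair // iv ik.
  by rewrite (pair_of_cosets_eq _ cC) // (leq_trans _ (K_gt n)).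
- by [].
Qed.
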